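(* There exists a randomized algorithm for asymmetric streaming pattern matching that, given a text $T$ with $|T|=n$ accessible by value queries and a pattern $P$ with $|P|=m$ arriving as a stream, makes a single pass over $P$, uses memory $O(1)$, runs in time $O(n+m)$, and correctly decides whether $P$ appears as a substring of $T$ with probability at least $0.99$.
   Context: Asymmetric streaming pattern matching: a text $T$ over a finite alphabet $\Sigma$ is available via value queries (in each query one gives an index $i$ and receives the $i$-th character of $T$), and a pattern $P$ over $\Sigma$ arrives as a stream of characters, read in order. The goal is to decide whether $P$ appears as a (contiguous) substring of $T$. Memory is measured in machine words (each able to hold an index or a number polynomial in $n$), not counting the read-only access to $T$. *)

(* Defs.v *)
(* A concrete model of computation for asymmetric streaming
   pattern matching: a word-RAM-style register machine with a constant number
   of registers (words), read-only value-query access to the text T, one-pass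
   forward-only access to the pattern stream P, and uniform random words. *)
From mathcomp Require Import all_boot.
Set Implicit Arguments. Unset Strict Implicit. Unset Printing Implicit Defensive.

(* Instructions.  Registers are indexed by nat; reading a register that does
   not exist yields 0, writing to it is a no-op (so memory size is fixed). *)
Inductive instr : Type :=
| ISet   (r v : nat)
| IAdd   (r a b : nat)
| ISub   (r a b : nat)
| IMul   (r a b : nat)
| IDiv   (r a b : nat)
| IMod   (r a b : nat)
| IJlt   (a b l : nat)
| IJmp   (l : nat)
| IQuery (r a : nat)          (* r := code of T[a] (1-based), 0 if a >= |T| *)
| IRead  (r : nat)            (* r := code of next pattern char, 0 at end   *)
| IRand  (r : nat)            (* r := fresh uniform random word in [0, W)   *)
| IAccept
| IReject.

Inductive status : Type := Running | Halted of bool | Failed.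

Record config : Type := Config {
  pc : nat;
  regs : seq nat;
  ppos : nat;
  rpos : nat;
  stat : status }.

Definition code (S : finType) (x : S) : nat := (enum_rank x).+1.

Definition rd (rs : seq nat) (a : nat) : nat := nth 0 rs a.
Definition wr (rs : seq nat) (r v : nat) : seq nat :=
  if r < size rs then set_nth 0 rs r v else rs.

(* One machine step; W is the word bound: every word must stay < W,
   otherwise the run fails (memory overflow). *)
Definition step (S : finType) (prog : seq instr) (W : nat) (T P : seq S)
    (seed : nat -> nat) (cf : config) : config :=
  match stat cf with
  | Running =>
    let rs := regs cf in
    let nx := (pc cf).+1 in
    let upd r v := Config nx (wr rs r v) (ppos cf) (rpos cf) Running in
    let cf' :=
      match onth prog (pc cf) with
      | None => Config (pc cf) rs (ppos cf) (rpos cf) Failed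
      | Some i =>
        match i with
        | ISet r v => upd r v
        | IAdd r a b => upd r (rd rs a + rd rs b)
        | ISub r a b => upd r (rd rs a - rd rs b)
        | IMul r a b => upd r (rd rs a * rd rs b)
        | IDiv r a b => upd r (rd rs a %/ rd rs b)
        | IMod r a b => upd r (rd rs a %% rd rs b)
        | IJlt a b l =>
            Config (if rd rs a < rd rs b then l else nx) rs (ppos cf) (rpos cf) Running
        | IJmp l => Config l rs (ppos cf) (rpos cf) Running
        | IQuery r a =>
            upd r (match onth T (rd rs a) with Some x => code x | None => 0 end)
        | IRead r =>
            match onth P (ppos cf) with
            | Some x => Config nx (wr rs r (code x)) (ppos cf).+1 (rpos cf) Running
            | None => Config nx (wr rs r 0) (ppos cf) (rpos cf) Running
            end
        | IRand r =>
            Config nx (wr rs r (seed (rpos cf))) (ppos cf) (rpos cf).+1 Running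
        | IAccept => Config (pc cf) rs (ppos cf) (rpos cf) (Halted true)
        | IReject => Config (pc cf) rs (ppos cf) (rpos cf) (Halted false)
        end
      end in
    if all (fun x => x < W) (regs cf') then cf'
    else Config (pc cf') (regs cf') (ppos cf') (rpos cf') Failed
  | _ => cf
  end.

Definition init_config (k n W : nat) : config :=
  let rs := n :: nseq k 0 in
  Config 0 rs 0 0 (if all (fun x => x < W) rs then Running else Failed).

Definition run (S : finType) (prog : seq instr) (k W : nat) (T P : seq S)
    (seed : nat -> nat) (t : nat) : status :=
  stat (iter t (step prog W T P seed) (init_config k (size T) W)).

Definition seed_of (t W : nat) (s : {ffun 'I_t -> 'I_W}) : nat -> nat :=
  fun i => match insub i with Some j => val (s j) | None => 0 end.

Definition halted_with (st : status) (b : bool) : bool :=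
  if st is Halted b' then b' == b else false.

(* Main.v *)
Require Import Defs.
From mathcomp Require Import all_boot zify.

(* The machine keeps a window T[i..i+j) that is compared with the prefix P[0..j)
   through Karp-Rabin fingerprints modulo M.  On a match the next character of P
   is read and the window grows; on a mismatch the window shifts right by one.
   The window end moves right at every round, so the time is linear, and the
   window start never jumps over an occurrence of P, so every occurrence is found.

   The modulus M is uniform in [1, R] up to a factor 2, with no primality
   requirement.  A false positive needs M to divide one of at most n + 1 nonzero
   differences of fingerprints.  Let y be a large multiple of (n + 2) ^ 2 and
   R = y ^ (2 * d).  If M has a prime factor p > y, then p is one of the few
   prime factors of these differences, and only a fraction 1/y of the moduli are
   multiples of a given such p.  The remaining M are y-smooth, and those form a
   fraction O(1/d) of [1, R], because the y-smooth part of R! is at most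
   y ^ (4 * R). *)

Set Implicit Arguments. Unset Strict Implicit. Unset Printing Implicit Defensive.

(** * Smooth numbers and the moduli that divide given integers *)

Lemma logn_fact_le p n : prime p -> logn p n`! <= 2 * (n %/ p).
Proof.
move=> pr_p; rewrite logn_fact //; case: n => [|n]; first by rewrite big_geq.
set N := n.+1.
(* The last term is counted twice; as the terms at least halve, this total does not grow with
   [m]. *)
suff h m : \sum_(1 <= k < m.+2) N %/ p ^ k + N %/ p ^ m.+1 <= 2 * (N %/ p).
  exact: leq_trans (leq_addr _ _) (h n).
elim: m => [|m IH]; first by rewrite big_nat1 expn1; lia.
rewrite big_nat_recr //=; apply: leq_trans IH.
have: 2 * (N %/ p ^ m.+2) <= N %/ p ^ m.+1.
  rewrite [p ^ m.+2]expnSr divnMA.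
  apply: leq_trans (leq_divM _ p); rewrite mulnC leq_mul2l.
  by rewrite prime_gt1 ?orbT.
lia.
Qed.

Lemma logn_fact_ge p n : prime p -> n %/ p <= logn p n`!.
Proof.
move=> pr_p; rewrite logn_fact //; case: n => [|n]; first by rewrite div0n.
by rewrite big_nat_recl // expn1 leq_addr.
Qed.

(** One factor 2 comes from the geometric series in Legendre's formula, the other from the floor in
    [y %/ p], which is at least 1. *)
Lemma logn_fact_mul p y q :
  prime p -> p <= y -> logn p (y * q)`! <= logn p (y`! ^ (4 * q)).
Proof.
move=> pr_p le_py; have p0 := prime_gt0 pr_p.
apply: (leq_trans (logn_fact_le _ pr_p)); rewrite lognX.
apply: (@leq_trans (4 * q * (y %/ p))); last by rewrite leq_mul2l logn_fact_ge ?orbT.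
suff: (y * q) %/ p <= 2 * q * (y %/ p) by lia.
rewrite -(mulnK (2 * q * (y %/ p)) p0); apply: leq_div2r.
have h1 : 0 < y %/ p by rewrite divn_gt0.
have h2 := ltn_ceil y p0.
have h3 : y <= 2 * (y %/ p) * p by nia.
nia.
Qed.

Lemma dvdn_logn m n : 0 < m -> 0 < n ->
  (forall p, p \in primes m -> logn p m <= logn p n) -> m %| n.
Proof.
move=> m0 n0 h; apply/dvdn_partP => // p pm.
have pr_p : prime p by move: pm; rewrite /= mem_primes => /andP[].
by rewrite p_part pfactor_dvdn // h.
Qed.

Lemma fact_leq_expn n : n`! <= n ^ n.
Proof.
suff h m : m <= n -> m`! <= n ^ m by exact: h.
elim: m => [//|m IH] lt_mn; rewrite factS expnS leq_mul //.
by apply: IH; apply: ltnW.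
Qed.

Definition smooth (y m : nat) := [pred p | p <= y].-nat m.

(* The product of these numbers is y-smooth and divides (y * q)!, hence divides
   y! ^ (4 * q) <= y ^ (4 * y * q), while each of them exceeds y ^ d. *)
Lemma count_smooth y d q : 1 < y ->
  d * \sum_(1 <= m < (y * q).+1) (smooth y m && (y ^ d < m)) <= 4 * (y * q).
Proof.
move=> y1; set R := y * q.
pose C m := smooth y m && (y ^ d < m).
pose F := \prod_(1 <= m < R.+1 | C m) m.
have Fy : [pred p | p <= y].-nat F.
  apply: (big_ind (fun m => [pred p | p <= y].-nat m)) => // [a b ha hb|m /andP[] //].
  by rewrite pnatM ha.
have F0 : 0 < F by case/andP: Fy.
have yq0 : 0 < y`! ^ (4 * q) by rewrite expn_gt0 fact_gt0.
have FR : F %| R`!.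
  by rewrite fact_prod (bigID C) /= dvdn_mulr.
have FY : F %| y`! ^ (4 * q).
  apply: dvdn_logn => // p pF.
  have pr_p : prime p by move: pF; rewrite mem_primes => /andP[].
  apply: leq_trans (dvdn_leq_log p (fact_gt0 R) FR) _.
  apply: logn_fact_mul => //.
  by case/andP: Fy => _ /allP/(_ _ pF).
have : (y ^ d) ^ (\sum_(1 <= m < R.+1) C m) <= y ^ (4 * R).
  apply: (@leq_trans F).
    rewrite expn_sum /F [leqRHS]big_mkcond /=; apply: leq_prod => m _.
    by rewrite /C; case: smooth => //=; case: ltnP => //= h; rewrite expn1 ltnW.
  apply: leq_trans (dvdn_leq yq0 FY) _.
  apply: (@leq_trans ((y ^ y) ^ (4 * q))); first by
    case: (4 * q) => // k; rewrite leq_exp2r ?fact_leq_expn.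
  by rewrite -expnM leq_exp2l // /R; lia.
by rewrite -expnM leq_exp2l.
Qed.

Lemma size_primes_exp n : 0 < n -> 2 ^ size (primes n) <= n.
Proof.
move=> n0; rewrite {2}(prod_prime_decomp n0) /primes size_map.
have: forall f, f \in prime_decomp n -> 1 < f.1 ^ f.2.
  move=> [p e] /mem_prime_decomp[pr_p e0 _] /=.
  by rewrite -[1](exp1n e) ltn_exp2r ?prime_gt1.
elim: (prime_decomp n) => [|f s IH] h; first by rewrite big_nil.
rewrite big_cons /= expnS leq_mul ?h ?mem_head //.
by apply: IH => g gs; apply: h; rewrite inE gs orbT.
Qed.

Lemma count_leq R K : \sum_(1 <= m < R.+1) (m <= K) = minn R K.
Proof.
elim: R => [|R IH]; first by rewrite big_geq ?min0n.
by rewrite big_nat_recr //= IH; case: (leqP R.+1 K); lia.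
Qed.

(** A modulus that is not [y]-smooth has a prime factor above [y], which also divides the [D] that
    the modulus divides. *)
Lemma has_dvdn_split y d Ds m : all (leq 1) Ds -> 0 < m ->
  has (dvdn m) Ds <=
    (m <= y ^ d) + (smooth y m && (y ^ d < m)) +
    \sum_(D <- Ds) \sum_(p <- primes D | y < p) (p %| m).
Proof.
move=> Ds0 m0; case: hasP => // -[D DDs mD].
case: leqP => // _; case: (boolP (smooth y m)) => // nsm /=.
rewrite !add0n lt0n sum_nat_seq_eq0; apply/negP => /allP /(_ D DDs) /=.
rewrite sum_nat_seq_eq0 => /allP h.
have D0 : 0 < D by move/allP: Ds0 => /(_ D DDs).
move: nsm; rewrite /smooth /pnat m0 /= => /allPn [p].
rewrite mem_primes inE -ltnNge => /and3P[pr_p _ pm] lt_yp.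
have := h p; rewrite mem_primes pr_p D0 (dvdn_trans pm mD) lt_yp pm.
by move=> /(_ isT).
Qed.

(** The three terms follow the cases of [has_dvdn_split]. In the last one, [D] has fewer than [L]
    prime factors, and each of those above [y] divides at most [q] of the moduli. *)
Lemma count_dvdn y d q L Ds : 1 < y ->
  all (fun D => 0 < D < 2 ^ L) Ds ->
  d * \sum_(1 <= m < (y * q).+1) has (dvdn m) Ds <=
    d * y ^ d + 4 * (y * q) + d * (size Ds * (L * q)).
Proof.
move=> y1 hDs; set R := y * q.
have Ds0 : all (leq 1) Ds by apply: sub_all hDs => D /andP[].
apply: (@leq_trans (d * (\sum_(1 <= m < R.+1)
    ((m <= y ^ d) + (smooth y m && (y ^ d < m)) +
    \sum_(D <- Ds) \sum_(p <- primes D | y < p) (p %| m))))).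
  rewrite leq_mul2l; apply/orP; right; rewrite big_nat [leqRHS]big_nat.
  by apply: leq_sum => m /andP[m0 _]; apply: has_dvdn_split.
rewrite !big_split /= !mulnDr; apply: leq_add; last first.
  rewrite leq_mul2l; apply/orP; right.
  rewrite exchange_big /= -sum1_size big_distrl /= big_seq [leqRHS]big_seq.
  apply: leq_sum => D DDs; rewrite mul1n exchange_big /=.
  have /andP[D0 DL] : 0 < D < 2 ^ L by move/allP: hDs => /(_ D DDs).
  apply: (@leq_trans (size (primes D) * q)); last first.
    rewrite leq_mul2r; apply/orP; right; apply: ltnW.
    by rewrite -(@ltn_exp2l 2) //; apply: leq_ltn_trans DL; apply: size_primes_exp.
  rewrite -sum1_size big_distrl /= big_mkcond /=; apply: leq_sum => p _.
  case: ltnP => // lt_yp; rewrite -divn_count_dvd mul1n /R.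
  apply: (@leq_trans (y * q %/ y)); last by rewrite mulKn //; lia.
  by apply: leq_div2l; lia.
apply: leq_add; last exact: count_smooth.
by rewrite count_leq leq_mul2l geq_minr orbT.
Qed.

(** * Uniform random words and their residues *)

Lemma sum_modn_periodic (f : nat -> nat) r k :
  \sum_(0 <= s < k * r) f (s %% r) = k * \sum_(0 <= s < r) f s.
Proof.
elim: k => [|k IH]; first by rewrite big_geq.
rewrite mulSnr mulSnr (big_cat_nat _ (n := k * r)) ?leq_addr //= IH; congr (_ + _).
rewrite -{1}[k * r]add0n big_addn addKn; rewrite big_nat [RHS]big_nat.
by apply: eq_bigr => i /andP[_ lt_ir]; rewrite addnC modnMDl modn_small.
Qed.

(** Each residue is hit at most [(W %/ r).+1] times, and [r] times this number is at most
    [2 * W]. *)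
Lemma sum_modn_leq (f : nat -> nat) r W : 0 < r <= W ->
  r * \sum_(0 <= s < W) f (s %% r) <= 2 * W * \sum_(0 <= s < r) f s.
Proof.
case/andP => r0 rW; set X := \sum_(0 <= s < r) f s.
have hW := ltn_ceil W r0; have h2 := leq_divM W r.
have h3 : 0 < W %/ r by rewrite divn_gt0.
have : \sum_(0 <= s < W) f (s %% r) <= (W %/ r).+1 * X.
  by rewrite -sum_modn_periodic [leqRHS](big_cat_nat _ (n := W)) ?leq_addr // ltnW.
move=> h; apply: (@leq_trans (r * ((W %/ r).+1 * X))); first by rewrite leq_mul2l h orbT.
rewrite mulnA leq_mul2r; apply/orP; right; nia.
Qed.

Lemma card_ffun_first t W (A : pred 'I_W) :
  #|[set s : {ffun 'I_t.+1 -> 'I_W} | A (s ord0)]| = #|A| * W ^ t.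
Proof.
pose F (j : 'I_t.+1) : pred 'I_W := if j == ord0 then A else predT.
rewrite (eq_card (B := family F)); last first.
  move=> s; rewrite inE; apply/idP/familyP => [As j|/(_ ord0)]; last by rewrite /F eqxx.
  by rewrite /F; case: eqP => [->|].
rewrite card_family foldrE big_image /= big_ord_recl /F /=.
by rewrite (eq_bigr (fun=> W)) ?prod_nat_const ?card_ord // => i _; rewrite cardT size_enum_ord.
Qed.

(** * Fingerprints of strings *)

Definition hash (S : finType) (B : nat) (s : seq S) :=
  foldl (fun a x => a * B + code x) 0 s.

(** The value that [IQuery] and [IRead] deliver. Codes are positive, so 0 marks the end of the
    string. *)
Definition query (S : finType) (s : seq S) i := oapp (@code S) 0 (onth s i).

Lemma query_gt0 (S : finType) (s : seq S) i : (0 < query s i) = (i < size s).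
Proof. by rewrite /query -onthTE; case: onth. Qed.

Lemma code_lt (S : finType) (x : S) : code x < #|S| + 2.
Proof. by rewrite /code addn2 !ltnS ltnW. Qed.

Lemma query_lt (S : finType) (s : seq S) i : query s i < #|S| + 2.
Proof.
by rewrite /query; case: onth => [x|] /=; [exact: code_lt | rewrite addn2].
Qed.

Lemma hash_rcons (S : finType) B (s : seq S) x :
  hash B (rcons s x) = hash B s * B + code x.
Proof. by rewrite /hash foldl_rcons. Qed.

Lemma hash_cat (S : finType) B (s1 s2 : seq S) :
  hash B (s1 ++ s2) = hash B s1 * B ^ size s2 + hash B s2.
Proof.
elim/last_ind: s2 => [|s x IH]; first by rewrite cats0 /= muln1 addn0.
by rewrite -rcons_cat !hash_rcons IH size_rcons expnSr mulnDl -mulnA addnA.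
Qed.

Lemma hash_lt (S : finType) (s : seq S) :
  hash (#|S| + 2) s < (#|S| + 2) ^ size s.
Proof.
elim/last_ind: s => [//|s x IH].
rewrite hash_rcons size_rcons expnSr; have := code_lt x; nia.
Qed.

(** Codes are smaller than the base, hence they are the digits of the hash: the last one is its
    residue, and the others follow by induction. *)
Lemma hash_inj (S : finType) (s1 s2 : seq S) : size s1 = size s2 ->
  hash (#|S| + 2) s1 = hash (#|S| + 2) s2 -> s1 = s2.
Proof.
elim/last_ind: s1 s2 => [|s1 x IH] s2; first by move/esym/size0nil.
case/lastP: s2 => [|s2 y]; rewrite !size_rcons // => -[es].
rewrite !hash_rcons => eh.
have exy : code x = code y.
  rewrite -(modn_small (code_lt x)) -(modn_small (code_lt y)).
  by rewrite -(modnMDl (hash (#|S| + 2) s1)) eh modnMDl.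
have hB : 0 < #|S| + 2 by rewrite addn2.
have -> : s1 = s2.
  by apply: IH => //; apply/eqP; rewrite -(eqn_pmul2r hB); apply/eqP; lia.
by congr rcons; apply: enum_rank_inj; apply: val_inj; case: exy.
Qed.

Lemma hash_take_modn (S : finType) B M (s : seq S) i : i < size s ->
  (hash B (take i s) %% M * B + query s i) %% M = hash B (take i.+1 s) %% M.
Proof.
rewrite /query => lt_is; case e: (onth s i) => [x|]; last first.
  by move: lt_is; rewrite -onthTE e.
rewrite (take_nth x lt_is) (onth_nth x _ _ _ e) hash_rcons.
by rewrite -modnDml modnMml modnDml.
Qed.

(** * Symbolic execution of programs *)

Definition fits W (rs : seq nat) := all (fun x => x < W) rs.

Arguments fits : simpl never.

(** A structurally recursive form of [wr], which simplifies on explicit lists of registers without a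
    size test. *)
Fixpoint update (rs : seq nat) r v : seq nat :=
  match rs, r with
  | [::], _ => [::]
  | _ :: rs', 0 => v :: rs'
  | x :: rs', r'.+1 => x :: update rs' r' v
  end.

Lemma wrE rs r v : wr rs r v = update rs r v.
Proof.
rewrite /wr; elim: rs r => [|x rs IH] [|r] //=.
by rewrite ltnS -IH; case: ifP.
Qed.

Lemma fits_update W rs r v : fits W rs -> v < W -> fits W (update rs r v).
Proof.
move=> + vW; rewrite /fits.
elim: rs r => [|x rs IH] [|r] //= /andP[xW rsW]; first by rewrite vW.
by rewrite xW IH.
Qed.

Definition arith (S : finType) (T : seq S) rs i : option (nat * nat) :=
  match i with
  | ISet r v => Some (r, v)
  | IAdd r a b => Some (r, rd rs a + rd rs b)
  | IMul r a b => Some (r, rd rs a * rd rs b)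
  | IMod r a b => Some (r, rd rs a %% rd rs b)
  | IQuery r a => Some (r, query T (rd rs a))
  | _ => None
  end.

Section Execution.

Variables (S : finType) (prog : seq instr) (W : nat) (T P : seq S).
Variables (seed : nat -> nat) (Q : config -> Prop).

Let next := step prog W T P seed.

(** Treats running time and outcome together: each rule below consumes one instruction and leaves
    the word bound as a side goal. *)
Definition within t cf := exists2 u, u <= t & Q (iter u next cf).

Lemma within_leq t' t cf : t' <= t -> within t' cf -> within t cf.
Proof. by move=> le_t [u le_u Qu]; exists u => //; apply: leq_trans le_t. Qed.

Lemma within_step t cf : within t (next cf) -> within t.+1 cf.
Proof. by case=> u le_u Qu; exists u.+1 => //; rewrite iterSr. Qed.

Lemma within_arith t pc rs pp rp i r v :
  onth prog pc = Some i -> arith T rs i = Some (r, v) -> v < W ->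
  (fits W (update rs r v) ->
   within t (Config pc.+1 (update rs r v) pp rp Running)) ->
  fits W rs -> within t.+1 (Config pc rs pp rp Running).
Proof.
move=> ei ai vW h rsW; apply: within_step.
have uW := fits_update r rsW vW.
suff -> : next (Config pc rs pp rp Running) =
    Config pc.+1 (update rs r v) pp rp Running by exact: h.
rewrite /next /step /= ei.
case: i {ei} ai => //=; intros;
  match goal with H : Some _ = Some _ |- _ => case: H => ? ?; subst r v end;
  by rewrite wrE ifT.
Qed.

Lemma within_jlt t pc rs pp rp a b l :
  onth prog pc = Some (IJlt a b l) ->
  (fits W rs ->
   within t (Config (if rd rs a < rd rs b then l else pc.+1) rs pp rp Running)) ->
  fits W rs -> within t.+1 (Config pc rs pp rp Running).
Proof.
move=> ei h rsW; apply: within_step.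
by rewrite /next /step /= ei /= -/(fits W _) rsW; apply: h.
Qed.

Lemma within_jmp t pc rs pp rp l :
  onth prog pc = Some (IJmp l) ->
  (fits W rs -> within t (Config l rs pp rp Running)) ->
  fits W rs -> within t.+1 (Config pc rs pp rp Running).
Proof.
move=> ei h rsW; apply: within_step.
by rewrite /next /step /= ei /= -/(fits W _) rsW; apply: h.
Qed.

Lemma within_read t pc rs pp rp r :
  onth prog pc = Some (IRead r) -> query P pp < W ->
  (fits W (update rs r (query P pp)) ->
   within t (Config pc.+1 (update rs r (query P pp))
               (pp + (pp < size P)) rp Running)) ->
  fits W rs -> within t.+1 (Config pc rs pp rp Running).
Proof.
move=> ei vW h rsW; apply: within_step.
have uW := fits_update r rsW vW.
move: {h} uW (h uW); rewrite /next /step /= ei /= /query -onthTE.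
by case: onth => [x|] /= uW; rewrite ?addn1 ?addn0 -/(fits W _) wrE uW.
Qed.

Lemma within_rand t pc rs pp rp r :
  onth prog pc = Some (IRand r) -> seed rp < W ->
  (fits W (update rs r (seed rp)) ->
   within t (Config pc.+1 (update rs r (seed rp)) pp rp.+1 Running)) ->
  fits W rs -> within t.+1 (Config pc rs pp rp Running).
Proof.
move=> ei vW h rsW; apply: within_step.
have uW := fits_update r rsW vW.
by rewrite /next /step /= ei /= wrE -/(fits W _) uW; apply: h.
Qed.

Lemma within_halt t pc rs pp rp b :
  onth prog pc = Some (if b then IAccept else IReject) ->
  Q (Config pc rs pp rp (Halted b)) ->
  fits W rs -> within t.+1 (Config pc rs pp rp Running).
Proof.
move=> ei h rsW; exists 1 => //=.
by rewrite /next /step /= ei; case: b ei h => ei h /=; rewrite -/(fits W _) rsW.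
Qed.

End Execution.

(** Halted configurations are fixed points, so an answer found early persists until time [t]. *)
Lemma iter_step_halted (S : finType) prog W (T P : seq S) seed b u t cf :
  u <= t -> stat (iter u (step prog W T P seed) cf) = Halted b ->
  stat (iter t (step prog W T P seed) cf) = Halted b.
Proof.
move=> le_ut; rewrite -(subnK le_ut) iterD; move: (iter u _ _) => c hc.
suff -> : iter (t - u) (step prog W T P seed) c = c by [].
by elim: (t - u) => [//|k IH]; rewrite iterS IH /step hc.
Qed.

(* Registers: 0 length n of T; 1 scratch; 2 base B; 3 modulus M; 4 constant 1;
   5 window start i; 6 window end e; 7, 8, 9 hashes of T[0..i), T[0..e) and of
   the part of P read so far; 10 B ^ (e - i); 11 current character. *)
Definition matcher (B : nat) : seq instr :=
  [:: ISet 4 1; ISet 2 B; IAdd 1 0 4; IAdd 1 1 4; IMul 1 1 1;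
      ISet 3 (600 * B); IMul 3 3 1;                               (* 0-6 *)
      IMul 3 3 3; IMul 3 3 3; IMul 3 3 3; IMul 3 3 3; IMul 3 3 3; IMul 3 3 3;
      IMul 3 3 3; IMul 3 3 3; IMul 3 3 3; IMul 3 3 3; IMul 3 3 3; IMul 3 3 3;
      IMul 3 3 3;                                                 (* 7-19 *)
      IRand 1; IMod 1 1 3; IAdd 3 1 4; IMod 10 4 3;               (* 20-23 *)
      IMul 1 7 10; IAdd 1 1 9; IMod 1 1 3;
      IJlt 1 8 37; IJlt 8 1 37;                                   (* 24-28 *)
      IRead 11; IJlt 11 4 49;
      IMul 9 9 2; IAdd 9 9 11; IMod 9 9 3;
      IMul 10 10 2; IMod 10 10 3; IJmp 42;                        (* 29-36 *)
      IQuery 11 5; IMul 7 7 2; IAdd 7 7 11; IMod 7 7 3;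
      IAdd 5 5 4;                                                 (* 37-41 *)
      IQuery 11 6; IJlt 11 4 50;
      IMul 8 8 2; IAdd 8 8 11; IMod 8 8 3; IAdd 6 6 4; IJmp 24;   (* 42-48 *)
      IAccept; IReject ].

Ltac arith_step :=
  eapply within_arith; [reflexivity | reflexivity | rewrite /rd /= | rewrite /rd /=].

(** * Loop invariant and correctness of the matcher *)

Section Matcher.

Variables (S : finType) (W : nat) (T P : seq S) (seed : nat -> nat).

Let B := #|S| + 2.
Let n := size T.
Let m := size P.

Definition window i k := take k (drop i T).
Definition occurs i := i + m <= n /\ window i m = P.
Definition collides M i k :=
  hash B (window i k) == hash B (take k P) %[mod M].

(** The test made by the program: adding the prefix hash of [T], shifted by [B ^ k], to both sides
    avoids subtraction modulo [M]. *)
Lemma collidesE M i k : i + k <= n ->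
  collides M i k =
  ((hash B (take i T) %% M * (B ^ k %% M) + hash B (take k P) %% M) %% M ==
     hash B (take (i + k) T) %% M).
Proof.
move=> le_ik; rewrite takeD hash_cat size_takel ?size_drop -/n; last by lia.
by rewrite -(modnDml (_ * _)) modnMm modnDml modnDmr eqn_modDl eq_sym.
Qed.

Lemma infix_occursP : reflect (exists i, occurs i) (infix P T).
Proof.
apply: (iffP (@infixP _ P T)) => [[p [q eT]]|[i [_ ei]]]; last first.
  exists (take i T), (drop m (drop i T)).
  move: (cat_take_drop m (drop i T)); rewrite -/(window i m) ei => ->.
  by rewrite cat_take_drop.
exists (size p); split; last by rewrite /window eT drop_size_cat // take_size_cat.
by rewrite /n eT !size_cat leq_add2l leq_addr.
Qed.

(** The error is one-sided: acceptance only certifies equal fingerprints, whereas rejection rules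
    out every occurrence from [i] on. *)
Definition answered M i cf := exists2 b : bool, stat cf = Halted b &
  (b -> exists2 i', i' + m <= n & collides M i' m) /\
  (forall i', i <= i' -> occurs i' -> b).

(** The invariant at the loop head, instruction 24: [j] characters of [P] and one random word are
    consumed; [x] and [y] are scratch values. *)
Definition loop_state M i j x y := Config 24
  [:: n; x; B; M; 1; i; i + j; hash B (take i T) %% M;
      hash B (take (i + j) T) %% M; hash B (take j P) %% M; B ^ j %% M; y]
  j 1 Running.

Lemma occurs_collides M i j : occurs i -> j <= m -> collides M i j.
Proof.
case=> _ e le_jm; rewrite /collides.
by have -> : window i j = take j P by rewrite -e /window take_takel.
Qed.

Variable M : nat.
Hypotheses (M0 : 0 < M) (nW : n + 2 < W) (BW : B < W).
Hypotheses (MM : M * M <= W) (MB : M * B <= W).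

Lemma modW a : a %% M < W.
Proof. by apply: leq_trans (ltn_pmod a M0) _; nia. Qed.

Lemma queryW (s : seq S) k : query s k < W.
Proof. exact: ltn_trans (query_lt _ _) BW. Qed.

Lemma mul_baseW a : a %% M * B < W.
Proof. by apply: leq_trans MB; rewrite ltn_pmul2r ?ltn_pmod // /B addn2. Qed.

Lemma hornerW a (s : seq S) k : a %% M * B + query s k < W.
Proof.
apply: leq_trans MB; have := ltn_pmod a M0; have := query_lt s k; rewrite -/B; nia.
Qed.

Lemma mul_addW a b c : a %% M * (b %% M) + c %% M < W.
Proof.
apply: leq_trans MM.
by have := ltn_pmod a M0; have := ltn_pmod b M0; have := ltn_pmod c M0; nia.
Qed.

(** The common tail of the match and shift branches: the window end advances over one character of
    [T], or the run rejects at the end of [T]. *)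
Lemma within_extend Q t i j e x y : i + j = e.+1 -> e <= n ->
  fits W [:: n; x; B; M; 1; i; e; hash B (take i T) %% M;
             hash B (take e T) %% M; hash B (take j P) %% M; B ^ j %% M; y] ->
  (e < n -> forall x y, fits W (regs (loop_state M i j x y)) ->
     within (matcher B) W T P seed Q t (loop_state M i j x y)) ->
  (e = n -> forall rs pp rp, Q (Config 50 rs pp rp (Halted false))) ->
  within (matcher B) W T P seed Q (7 + t)
    (Config 42 [:: n; x; B; M; 1; i; e; hash B (take i T) %% M;
             hash B (take e T) %% M; hash B (take j P) %% M; B ^ j %% M; y]
     j 1 Running).
Proof.
move=> eij le_en + Hin Hout.
arith_step; first exact: queryW.
eapply within_jlt; [reflexivity | rewrite /rd /=].
rewrite ltnS leqNgt query_gt0; case: ltnP => [lt_en|le_ne] /=; last first.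
  by apply: (@within_halt _ _ _ _ _ _ _ _ _ _ _ _ false) => //; apply: Hout; lia.
arith_step; first exact: mul_baseW.
arith_step; first exact: hornerW.
arith_step; first exact: modW.
arith_step; first by lia.
rewrite hash_take_modn // addn1 -eij.
eapply within_jmp; [reflexivity|].
exact: Hin.
Qed.

Lemma answered_succ i cf :
  ~ occurs i -> answered M i.+1 cf -> answered M i cf.
Proof.
move=> not_i [b sb [h1 h2]]; exists b => //; split=> // i' le_i oc.
by apply: (h2 i') => //; rewrite ltn_neqAle le_i andbT; apply: contra_notN not_i => /eqP ->.
Qed.

(** Induction on the distance from the window end to the end of [T]. The longest round is a match,
    with 13 instructions followed by the 7 of the common tail. *)
Lemma loop_answered N i j x y : n - (i + j) < N -> i + j <= n -> j <= m ->
  fits W (regs (loop_state M i j x y)) ->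
  within (matcher B) W T P seed (answered M i) (20 * N) (loop_state M i j x y).
Proof.
elim: N i j x y => [//|N IH] i j x y lt_N le_ij le_jm.
rewrite mulnS /loop_state /=.
arith_step; first by have := mul_addW (hash B (take i T)) (B ^ j) 0; rewrite mod0n addn0.
arith_step; first exact: mul_addW.
arith_step; first exact: modW.
set hl := (_ + _) %% M.
have eC : collides M i j = (hl == hash B (take (i + j) T) %% M) by exact: collidesE.
have shift : ~~ collides M i j ->
    fits W [:: n; hl; B; M; 1; i; i + j; hash B (take i T) %% M;
      hash B (take (i + j) T) %% M; hash B (take j P) %% M; B ^ j %% M; y] ->
    within (matcher B) W T P seed (answered M i) (12 + 20 * N)
      (Config 37 [:: n; hl; B; M; 1; i; i + j; hash B (take i T) %% M;
      hash B (take (i + j) T) %% M; hash B (take j P) %% M; B ^ j %% M; y] j 1 Running).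
  move=> nC.
  have not_i : ~ occurs i by move=> oc; case/negP: nC; apply: occurs_collides.
  (* An empty window always matches, so a mismatch has [j > 0] and [i] lies inside [T]. *)
  have lt_in : i < size T.
    case: j nC le_ij {le_jm lt_N hl eC} => [|j]; last by rewrite -/n; lia.
    by rewrite /collides /window !take0 eqxx.
  arith_step; first exact: queryW.
  arith_step; first exact: mul_baseW.
  arith_step; first exact: hornerW.
  arith_step; first exact: modW.
  arith_step; first by rewrite -/n in lt_in; lia.
  rewrite hash_take_modn // addn1 => fitsW; apply: within_extend => //.
    move=> lt_e x' y' fits'.
    have [] := IH i.+1 j x' y' _ _ le_jm fits';
      [by clear -lt_N lt_e; lia | by clear -lt_e; lia |].
    by move=> u le_u Qu; exists u => //; apply: answered_succ Qu.
  (* The window ends at the end of [T], so an occurrence from [i] on could only start at [i] itself,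
     which the mismatch excludes. *)
  move=> e_n rs pp rp; exists false => //; split=> // i' le_i [le_n oc].
  have [e_i e_m] : i' = i /\ j = m by clear -le_i le_n e_n le_jm; lia.
  by case: not_i; rewrite -e_i.
eapply within_jlt; [reflexivity | rewrite /rd /=].
case: ltngtP eC => [lt_h|lt_h|e_h] eC.
- by move=> fitsW; apply: within_leq (shift _ fitsW); rewrite ?eC //; lia.
- eapply within_jlt; [reflexivity | rewrite /rd /= lt_h].
  by move=> fitsW; apply: within_leq (shift _ fitsW); rewrite ?eC //; lia.
eapply within_jlt; [reflexivity | rewrite /rd /= e_h ltnn].
eapply within_read; [reflexivity | exact: queryW | rewrite /=].
eapply within_jlt; [reflexivity | rewrite /rd /=].
rewrite ltnS leqNgt query_gt0 -/m; case: ltnP => [lt_jm|le_mj] /=; last first.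
  have e_jm : j = m by apply/eqP; rewrite eqn_leq le_jm.
  apply: (@within_halt _ _ _ _ _ _ _ _ _ _ _ _ true) => //; exists true => //.
  by split=> // _; exists i; rewrite -e_jm ?eC.
arith_step; first exact: mul_baseW.
arith_step; first exact: hornerW.
arith_step; first exact: modW.
arith_step; first exact: mul_baseW.
arith_step; first exact: modW.
rewrite hash_take_modn // modnMml -expnSr addn1.
eapply within_jmp; [reflexivity|].
move=> fitsW; apply: within_extend fitsW _ _ => //.
- by rewrite addnS.
- move=> lt_e x' y' fits'; by apply: IH => //; clear -lt_N lt_e; lia.
(* Fewer than [m] characters of [T] remain from [i] on. *)
move=> e_n rs pp rp; exists false => //; split=> // i' le_i [le_n _].
by clear -le_i le_n e_n lt_jm; lia.
Qed.
End Matcher.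

(** * Initialization and choice of the modulus *)

Lemma within_init (S : finType) W (T P : seq S) seed Q t R b :
  let B := #|S| + 2 in
  R = (600 * B * (size T + 2) ^ 2) ^ (2 ^ 13) -> R * R <= W -> b < W ->
  seed 0 = b ->
  (let M := b %% R + 1 in
   forall x, fits W (regs (loop_state T P M 0 0 x 0)) ->
     within (matcher B) W T P seed Q t (loop_state T P M 0 0 x 0)) ->
  within (matcher B) W T P seed Q (24 + t) (init_config 11 (size T) W).
Proof.
move=> B; set n := size T; set y := 600 * B * _ => + RW bW eb Hin.
have y_ge : 600 * B <= y /\ (n + 2) ^ 2 <= y.
  by split; [apply: leq_pmulr; rewrite expn_gt0 addn2 | apply: leq_pmull; rewrite /B addn2].
have n_le : n + 2 <= (n + 2) ^ 2 by rewrite -{1}[n + 2]expn1 leq_exp2l ?addn2.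
have B2 : 1 < B by rewrite /B addn2.
have y1 : 1 < y by move: (leq_trans n_le y_ge.2); lia.
have y0 : 0 < y by apply: ltnW.
have sq k : y ^ (2 ^ k) * y ^ (2 ^ k) = y ^ (2 ^ k.+1).
  by rewrite -expnD addnn -mul2n -expnS.
have pow_gt1 k : 1 < y ^ (2 ^ k).
  by apply: leq_trans y1 _; rewrite -{1}[y]expn1 leq_pexp2l // expn_gt0.
(* A variable for 13 keeps [2 ^ 13] from being evaluated. *)
have [q] : exists q, q = 13 by exists 13.
move=> eq_q; rewrite -{1}eq_q => eR.
have R1 : 1 < R by rewrite eR.
have R_lt : R < W by apply: leq_trans RW; rewrite ltn_Pmull // ltnW.
have powW k : k <= q -> y ^ (2 ^ k) < W.
  by move=> le_k; apply: leq_ltn_trans R_lt; rewrite eR leq_pexp2l // leq_pexp2l.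
have yW : y < W by have := powW 0 isT; rewrite expn1.
have fits0 : fits W (n :: nseq 11 0) by rewrite /fits /=; lia.
rewrite /init_config -/(fits W _) fits0; move: fits0; rewrite /=.
arith_step; first by lia.
arith_step; first by lia.
arith_step; first by lia.
rewrite addn1; arith_step; first by lia.
rewrite addn1 -addn2; arith_step; first by rewrite mulnn; lia.
rewrite mulnn; arith_step; first by lia.
rewrite -/y; arith_step; first exact: yW.
rewrite (_ : 600 * B * _ = y ^ (2 ^ 0)); last by rewrite expn1.
do 13! (arith_step; [by rewrite sq powW ?eq_q | rewrite sq]).
rewrite (_ : y ^ (2 ^ 13) = R); last by rewrite eR eq_q.
eapply within_rand; [reflexivity | by rewrite eb | rewrite /= eb].
have bR : b %% R < R by rewrite ltn_mod ltnW.
arith_step; first by apply: ltn_trans R_lt.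
arith_step; first by rewrite addn1; apply: leq_ltn_trans R_lt.
(* The power [B ^ 0] is stored as [1 %% M], which is 0 when [M = 1]. *)
arith_step; first by apply: leq_ltn_trans (leq_mod _ _) _; apply: ltn_trans R_lt.
by move: (Hin (b %% R)); rewrite /loop_state addn0 !take0 /= mod0n; apply.
Qed.

(** * Error probability and word size *)

(** Each of the three terms of [count_dvdn] is at most [d * R / 600]: by [y >= 600], by [d >= 2400],
    and by the factor [600 * B * (n + 2) ^ 2] in [R]. *)
Lemma count_bad n B d Ds : 0 < B -> 2400 <= d -> size Ds <= n.+1 ->
  all (fun D => 0 < D < 2 ^ (B * n)) Ds ->
  let R := (600 * B * (n + 2) ^ 2) ^ (2 * d) in
  is_true (200 * \sum_(1 <= m < R.+1) has (dvdn m) Ds <= R).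
Proof.
move=> B0 d_ge szDs hDs; set y := 600 * B * _ => R.
have y_ge : 600 <= y by rewrite /y -mulnA leq_pmulr // muln_gt0 B0 expn_gt0 addn2.
have y1 : 1 < y by apply: leq_trans y_ge.
have d0 : 0 < d by apply: leq_trans d_ge.
pose q := y ^ (2 * d).-1.
have eR : y * q = R by rewrite -expnS prednK // muln_gt0 d0.
have := count_dvdn d q y1 hDs; rewrite eR; set X := \sum_(_ <= _ < _) _ => hX.
have small : 600 * y ^ d <= R.
  rewrite /R mul2n -addnn expnD leq_mul2r; apply/orP; right.
  by apply: leq_trans y_ge _; rewrite -{1}[y]expn1 leq_pexp2l // ltnW.
have large : 600 * (size Ds * (B * n * q)) <= R.
  have le_sq : size Ds * n <= (n + 2) ^ 2.
    by rewrite -mulnn leq_mul ?leq_addr // (leq_trans szDs) // addn2.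
  have mono a b c : b * n <= c -> 600 * (b * (B * n * a)) <= 600 * B * c * a.
    move=> h; rewrite (_ : 600 * _ = 600 * B * (b * n) * a); last by clear; lia.
    by rewrite leq_mul // leq_mul.
  by rewrite -eR; apply: mono.
move: small large hX; set s := y ^ d; set l := size Ds * _ => small large hX.
rewrite -(@leq_pmul2l (3 * d)) ?muln_gt0 ?d0 //.
have h4 : 2400 * R <= d * R by rewrite leq_mul2r d_ge orbT.
have h5 : d * (600 * s) <= d * R by rewrite leq_mul2l small orbT.
have h6 : d * (600 * l) <= d * R by rewrite leq_mul2l large orbT.
move: hX h4 h5 h6; rewrite -[3 * d * R]mulnA.
rewrite (_ : 3 * d * (200 * X) = 600 * (d * X)); last by rewrite mulnACA.
rewrite ![d * (600 * _)]mulnCA.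
by move: (d * R) (d * X) (d * s) (d * l) => *; lia.
Qed.

(** The exponent stems from the thirteen squarings in [matcher]; it is [2 * d] with [d = 2 ^ 12],
    which exceeds 2400. *)
Definition modulus_bound B n := (600 * B * (n + 2) ^ 2) ^ (2 ^ 13).

(** Chosen so that words hold the square of the modulus bound, using [600 <= 2 ^ 10] and
    [B <= 2 ^ B]. *)
Definition word_exponent B := (B + 12) * 2 ^ 14.

Lemma modulus_bound_sqr B n :
  modulus_bound B n * modulus_bound B n <= (n + 2) ^ word_exponent B.
Proof.
rewrite /modulus_bound /word_exponent -expnD addnn -mul2n -expnS expnM.
rewrite leq_exp2r ?expn_gt0 // (_ : B + 12 = 10 + B + 2); last by lia.
have h2 k : 2 ^ k <= (n + 2) ^ k by case: k => // k; rewrite leq_exp2r ?addn2.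
rewrite expnD leq_mul2r; apply/orP; right.
rewrite expnD leq_mul ?(leq_trans _ (h2 _)) //.
by apply: ltnW; apply: ltn_expl.
Qed.

Lemma modulus_bound_ge B n : 0 < B -> B + n + 3 <= modulus_bound B n.
Proof.
move=> B0; rewrite /modulus_bound; set y := 600 * B * _.
have hy : B + n + 3 <= y by rewrite /y -mulnn; nia.
apply: leq_trans hy _; rewrite -{1}[y]expn1 leq_pexp2l ?expn_gt0 //.
by rewrite /y !muln_gt0 B0 addn2.
Qed.

Lemma run_matcher (S : finType) (T P : seq S) seed :
  let B := #|S| + 2 in
  let W := (size T + 2) ^ word_exponent B in
  let M := seed 0 %% modulus_bound B (size T) + 1 in
  seed 0 < W ->
  exists b : bool,
    [/\ run (matcher B) 11 W T P seed (50 * (size T + size P + 1)) = Halted b,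
        infix P T -> b &
        b -> exists2 i, i + size P <= size T & collides T P M i (size P)].
Proof.
move=> B W M s0W; set R := modulus_bound B (size T) in M *.
have RW : R * R <= W by exact: modulus_bound_sqr.
have B0 : 1 < B by rewrite /B addn2.
have R_ge : B + size T + 3 <= R by apply: modulus_bound_ge; apply: ltnW.
have M0 : 0 < M by rewrite /M addn1.
have MR : M <= R by rewrite /M addn1 ltn_mod; lia.
have R_lt : R < W by apply: leq_trans RW; rewrite ltn_Pmull; lia.
have MM : M * M <= W by apply: leq_trans RW; rewrite leq_mul.
have MB : M * B <= W by apply: leq_trans RW; rewrite leq_mul //; lia.
have BW : B < W by lia.
have nW : size T + 2 < W by lia.
have [] : within (matcher B) W T P seed (answered T P M 0)
    (24 + 20 * (size T).+1) (init_config 11 (size T) W).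
  apply: (within_init (R := R) _ _ s0W) => // M' x fitsx.
  by apply: loop_answered fitsx; rewrite ?subn0.
move=> u le_u [b sb [b1 b2]]; exists b; split => //.
  by apply: iter_step_halted sb; lia.
by move/infix_occursP => [i]; apply: b2.
Qed.

(** The sum of both truncated subtractions is the absolute difference. Zeros are dropped, as they
    stem from true occurrences and every modulus divides them. *)
Definition differences (S : finType) (T P : seq S) :=
  let h s := hash (#|S| + 2) s in
  [seq D <- [seq (h (window T i (size P)) - h P) + (h P - h (window T i (size P)))
            | i <- iota 0 ((size T).+1 - size P)] | 0 < D].

Lemma differences_lt (S : finType) (T P : seq S) :
  all (fun D => 0 < D < 2 ^ ((#|S| + 2) * size T)) (differences T P).
Proof.
apply/allP => D; rewrite mem_filter => /andP[-> /mapP[i]].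
rewrite mem_iota => lt_i ->; set B := #|S| + 2.
have hs (s : seq S) : size s <= size T -> hash B s < 2 ^ (B * size T).
  move=> le_s; apply: leq_trans (hash_lt s) _; rewrite -/B.
  apply: (@leq_trans (B ^ size T)); first by rewrite leq_pexp2l // /B addn2.
  rewrite expnM; case: (size T) => // k; rewrite leq_exp2r //.
  by apply: ltnW; apply: ltn_expl.
have h1 : size P <= size T by lia.
have := hs _ h1; have := hs (window T i (size P)).
rewrite /window size_takel ?size_drop; last by lia.
by move=> /(_ h1); set a := hash _ _; set b := hash _ _; set X := 2 ^ _; lia.
Qed.

(** Equal residues make [M] divide the difference of the hashes, which must then be zero; [hash_inj]
    concludes. *)
Lemma collides_infix (S : finType) (T P : seq S) M i : i + size P <= size T ->
  ~~ has (dvdn M) (differences T P) -> collides T P M i (size P) -> infix P T.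
Proof.
move=> le_i /hasPn nD; rewrite /collides take_size => eM.
apply/infix_occursP; exists i; split => //.
apply: hash_inj; first by rewrite size_takel // size_drop; lia.
set D := (hash (#|S| + 2) (window T i (size P)) - hash (#|S| + 2) P) +
  (hash (#|S| + 2) P - hash (#|S| + 2) (window T i (size P))).
have MD : M %| D.
  rewrite dvdn_add //.
    case: (leqP (hash (#|S| + 2) P) (hash (#|S| + 2) (window T i (size P)))) => [h|/ltnW h].
      by rewrite -eqn_mod_dvd.
    by rewrite (eqP (_ : _ - _ == 0)) ?dvdn0 // subn_eq0.
  case: (leqP (hash (#|S| + 2) (window T i (size P))) (hash (#|S| + 2) P)) => [h|/ltnW h].
    by rewrite -eqn_mod_dvd // eq_sym.
  by rewrite (eqP (_ : _ - _ == 0)) ?dvdn0 // subn_eq0.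
have D0 : ~~ (0 < D).
  apply/negP => D0; suff Din : D \in differences T P.
    by move: (nD D Din); rewrite MD.
  rewrite mem_filter D0; apply/mapP; exists i => //.
  by rewrite mem_iota; clear -le_i; lia.
by move: D0; rewrite /D; lia.
Qed.

(** At most 1/200 of the residues are bad by [count_bad], and reducing a uniform word modulo [R] at
    most doubles this fraction. *)
Lemma card_good_words (S : finType) (T P : seq S) :
  let B := #|S| + 2 in
  let W := (size T + 2) ^ word_exponent B in
  let R := modulus_bound B (size T) in
  is_true (99 * W <= 100 *
    #|[pred w : 'I_W | ~~ has (dvdn (w %% R + 1)) (differences T P)]|).
Proof.
move=> B W R; set A := [pred w : 'I_W | _].
have B0 : 0 < B by rewrite /B addn2.
have R_ge : B + size T + 3 <= R by exact: modulus_bound_ge.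
have RW : R <= W.
  by apply: leq_trans (modulus_bound_sqr B (size T)); rewrite -/R; nia.
pose f r : nat := has (dvdn (r + 1)) (differences T P).
have hf : 200 * \sum_(0 <= r < R) f r <= R.
  have -> : \sum_(0 <= r < R) f r =
      \sum_(1 <= m < R.+1) has (dvdn m) (differences T P).
    by rewrite big_add1 /=; apply: eq_bigr => r _; rewrite /f addn1.
  rewrite /R /modulus_bound expnS; apply: count_bad (differences_lt T P) => //.
  by rewrite size_filter (leq_trans (count_size _ _)) // size_map size_iota leq_subr.
have hW : R * \sum_(0 <= w < W) f (w %% R) <= 2 * W * \sum_(0 <= r < R) f r.
  by apply: sum_modn_leq; rewrite RW andbT; lia.
have eA : #|[predC A]| = \sum_(0 <= w < W) f (w %% R).
  rewrite big_mkord -sum1_card big_mkcond /=; apply: eq_bigr => w _.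
  by rewrite !inE negbK /f; case: has.
have : 100 * #|[predC A]| <= W.
  rewrite eA -(@leq_pmul2l R); last by lia.
  move: hf hW; move: (\sum_(_ <= _ < _) f _) (\sum_(_ <= _ < _) f _) => a b; nia.
by move: (cardC A); rewrite card_ord; move: #|[predC A]| #|A| => b a; clear; lia.
Qed.

(* There is a program using k+1 words of size < (n+2)^c (constants k, c,
   i.e. O(1) memory of words polynomial in n), reading P once, that on every
   random seed halts within C*(n+m+1) steps without memory overflow, and whose
   answer equals "P occurs contiguously in T" with probability >= 99/100. *)
Theorem theorem1 (S : finType) :
  exists (prog : seq instr) (k c C : nat),
    forall T P : seq S,
      let W := (size T + 2) ^ c in
      let t := C * (size T + size P + 1) in
      (forall seed : nat -> nat, (forall i, seed i < W) ->
         exists b : bool, run prog k W T P seed t = Halted b) /\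
      99 * W ^ t <=
        100 * #|[set s : {ffun 'I_t -> 'I_W} |
                  halted_with (run prog k W T P (seed_of s) t) (infix P T)]|.
Proof.
exists (matcher (#|S| + 2)), 11, (word_exponent (#|S| + 2)), 50 => T P W t.
split=> [seed hs|].
  by have [b [hb _ _]] := run_matcher (T := T) P (hs 0); exists b.
pose A (w : 'I_W) :=
  ~~ has (dvdn (w %% modulus_bound (#|S| + 2) (size T) + 1)) (differences T P).
have good : 99 * W <= 100 * #|A| by exact: card_good_words.
have [t' et] : exists t', t = t'.+1 by exists t.-1; rewrite prednK // muln_gt0 addn1.
(* The first random word is addressed by an index of value 0, since [ord0] is available only once
   [t] is rewritten as a successor. *)
have : forall s : {ffun 'I_t -> 'I_W}, (exists2 j : 'I_t, j = 0 :> nat & A (s j)) ->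
    halted_with (run (matcher (#|S| + 2)) 11 W T P (seed_of s) t) (infix P T).
  move=> s [j j0 As].
  have es : seed_of s 0 = s j.
    rewrite /seed_of; case: insubP => [k _ ek|]; last first.
      by case/negP; apply: leq_ltn_trans (leq0n j) (ltn_ord j).
    by congr (val (s _)); apply: val_inj; exact: etrans ek (esym j0).
  have [|b [hb b1 b2]] := run_matcher (T := T) P (seed := seed_of s).
    by rewrite es; apply: ltn_ord.
  rewrite hb /=; apply/eqP; apply/idP/idP => [/b2[i le_i]|/b1 //].
  by apply: collides_infix => //; rewrite es.
rewrite et => hA.
apply: (@leq_trans (100 * #|[set s : {ffun 'I_t'.+1 -> 'I_W} | A (s ord0)]|)).
  by rewrite card_ffun_first expnS !mulnA leq_mul2r good orbT.
rewrite leq_mul2l; apply/orP; right; apply: subset_leq_card; apply/subsetP => s.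
by rewrite !inE => As; apply: hA; exists ord0.
Qed.
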